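(* Let $X$ be a function space (a real vector space of $\mathbb{R}^3$-valued functions), $\alpha\in\mathbb{R}$, and let $E$ be a real-valued functional defined on a set $V\subset X$ of admissible functions such that $r\gamma\in V$ and $E(r\gamma)=r^\alpha E(\gamma)$ for all $r>0$ and all $\gamma\in V$. Assume there exists a stationary point $\gamma\in V$ of $E$, i.e. $\delta E(\gamma,\Phi)=0$ for all $\Phi\in X$. Then $$\alpha=0\qquad\text{or}\qquad E(\gamma)=0 .$$ In this case, $\delta E(r\gamma,\Phi)=0$ for all $\Phi\in X$ and all $r>0$.
   Context: The first variation of $E$ at $\gamma\in V$ in direction $\Phi\in X$ is defined if $\gamma+\tau\Phi\in V$ for all sufficiently small $|\tau|$ and the limit $$\delta E(\gamma,\Phi):=\frac{d}{d\tau}\Big|_{\tau=0}E(\gamma+\tau\Phi)=\lim_{\tau\to0}\frac{E(\gamma+\tau\Phi)-E(\gamma)}{\tau}$$ exists. The assumption that $\gamma$ is a stationary point includes that $\delta E(\gamma,\Phi)$ is defined for every $\Phi\in X$. *)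

(* Defs.v *)
From HB Require Import structures.
From mathcomp Require Export all_boot all_order all_algebra.
From mathcomp Require Export all_classical all_reals all_analysis.

Set Implicit Arguments.
Unset Strict Implicit.
Unset Printing Implicit Defensive.

Import Order.TTheory GRing.Theory Num.Theory.
Import numFieldNormedType.Exports.

Local Open Scope classical_set_scope.
Local Open Scope ring_scope.

(* A functional defined on a set V of functions is given by a total function
   E: first_variation_defined and, where it holds, first_variation do not
   depend on the values of E outside V. *)
Section first_variation.
Variables (R : realType) (T : Type).
Implicit Types (X V : set (T -> 'rV[R]_3)) (E : (T -> 'rV[R]_3) -> R).
Implicit Types gamma Phi : T -> 'rV[R]_3.

Definition variation_quotient E gamma Phi (tau : R) : R :=
  (E (gamma + tau *: Phi) - E gamma) / tau.

Definition first_variation_defined V E gamma Phi : Prop :=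
  (\forall tau \near (0 : R), V (gamma + tau *: Phi)) /\
  cvg (variation_quotient E gamma Phi tau @[tau --> (0 : R)^']).

(* Meaningful only under first_variation_defined. *)
Definition first_variation E gamma Phi : R :=
  lim (variation_quotient E gamma Phi tau @[tau --> (0 : R)^']).

Definition stationary X V E gamma : Prop :=
  forall Phi, X Phi ->
    first_variation_defined V E gamma Phi /\ first_variation E gamma Phi = 0.

End first_variation.

(* Main.v *)
Require Import Defs.

(* Testing stationarity in the direction [gamma] itself, homogeneity gives
   [0 = d/dtau (1 + tau)^alpha E(gamma) = alpha E(gamma)] at [tau = 0].
   For the second claim, [E (r gamma + tau Phi) = r^alpha E (gamma + tau Phi / r)],
   so the variation at [r gamma] in direction [Phi] is [r^alpha] times the one
   at [gamma] in direction [Phi / r]. *)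

Import Order.TTheory GRing.Theory Num.Theory.
Import numFieldNormedType.Exports.

Local Open Scope classical_set_scope.
Local Open Scope ring_scope.

Set Implicit Arguments.
Unset Strict Implicit.

Section homogeneous_functional.
Variables (R : realType) (T : Type) (alpha : R).
Variables (V : set (T -> 'rV[R]_3)) (E : (T -> 'rV[R]_3) -> R).
Hypothesis V_scale : forall (r : R) (gamma : T -> 'rV[R]_3),
  0 < r -> V gamma -> V (r *: gamma).
Hypothesis E_homogeneous : forall (r : R) (gamma : T -> 'rV[R]_3),
  0 < r -> V gamma -> E (r *: gamma) = r `^ alpha * E gamma.
Implicit Types gamma Phi : T -> 'rV[R]_3.

(** This is the difference quotient at 1 of the power function with exponent [alpha], whose
    derivative there is alpha * 1^(alpha - 1). *)
Lemma cvg_powR_quotient1 :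
  ((1 + tau) `^ alpha - 1) / tau @[tau --> (0 : R)^'] --> alpha.
Proof.
have [dpow] := is_derive1_powR alpha (@ltr01 R).
rewrite powR1 mulr1 => Dpow; rewrite -[X in _ --> X]Dpow.
apply: cvg_trans dpow; apply: near_eq_cvg; near=> tau.
by rewrite /= powR1 [tau%:A]mulr1 (addrC tau) [LHS]mulrC.
Unshelve. all: by end_near. Qed.

Lemma cvg_radial_variation gamma : V gamma ->
  variation_quotient E gamma gamma tau @[tau --> (0 : R)^']
    --> alpha * E gamma.
Proof.
move=> Vg; apply: cvg_trans (cvgMr_tmp (b := E gamma) cvg_powR_quotient1).
apply: near_eq_cvg; near=> tau; rewrite /variation_quotient.
(* Homogeneity covers positive factors only; [1 + tau] is one as soon as [tau > -1], hence near
   0. *)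
have tau1 : 0 < 1 + tau.
  rewrite -ltrBlDl sub0r; near: tau.
  by apply: nbhs_dnbhs; apply: lt_nbhsr; rewrite oppr_lt0.
have -> : gamma + tau *: gamma = (1 + tau) *: gamma.
  by rewrite scalerDl scale1r.
by rewrite E_homogeneous// mulrAC mulrBl mul1r.
Unshelve. all: by end_near. Qed.

Lemma scale_direction (r tau : R) Phi : 0 < r ->
  r *: (tau *: (r^-1 *: Phi)) = tau *: Phi.
Proof. by move=> r0; rewrite !scalerA mulrAC mulfV ?gt_eqF// mul1r. Qed.

Lemma near_admissible_scale (r : R) gamma Phi : 0 < r ->
  (\forall tau \near (0 : R), V (gamma + tau *: (r^-1 *: Phi))) ->
  \forall tau \near (0 : R), V (r *: gamma + tau *: Phi).
Proof.
move=> r0; apply: filterS => tau /(V_scale r0).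
by rewrite scalerDr scale_direction.
Qed.

Lemma cvg_variation_scale (r l : R) gamma Phi : 0 < r -> V gamma ->
  (\forall tau \near (0 : R), V (gamma + tau *: (r^-1 *: Phi))) ->
  variation_quotient E gamma (r^-1 *: Phi) tau @[tau --> (0 : R)^'] --> l ->
  variation_quotient E (r *: gamma) Phi tau @[tau --> (0 : R)^']
    --> r `^ alpha * l.
Proof.
move=> r0 Vg Vnear cvg_l; apply: cvg_trans (cvgMl_tmp (a := r `^ alpha) cvg_l).
apply: near_eq_cvg; near=> tau; rewrite /variation_quotient.
(* Homogeneity holds on [V] only, so the perturbed point must be admissible before r^alpha can be
   absorbed into its energy. *)
have Vtau : V (gamma + tau *: (r^-1 *: Phi)).
  by near: tau; exact: nbhs_dnbhs.
by rewrite mulrA mulrBr -!E_homogeneous// scalerDr scale_direction.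
Unshelve. all: by end_near. Qed.

End homogeneous_functional.

Theorem corollary2p45 (R : realType) (T : Type)
    (X : set (T -> 'rV[R]_3)) (hX : GRing.submod_closed [in X])
    (alpha : R) (V : set (T -> 'rV[R]_3)) (hVX : V `<=` X)
    (E : (T -> 'rV[R]_3) -> R)
    (hV : forall (r : R) (gamma : T -> 'rV[R]_3),
        0 < r -> V gamma -> V (r *: gamma))
    (hE : forall (r : R) (gamma : T -> 'rV[R]_3),
        0 < r -> V gamma -> E (r *: gamma) = r `^ alpha * E gamma)
    (gamma : T -> 'rV[R]_3) (hgamma : V gamma)
    (hstat : stationary X V E gamma) :
  (alpha = 0 \/ E gamma = 0) /\
  (forall (r : R), 0 < r -> forall Phi : T -> 'rV[R]_3, X Phi ->
     first_variation_defined V E (r *: gamma) Phi /\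
     first_variation E (r *: gamma) Phi = 0).
Proof.
split.
  (* Since [V] lies in [X], [gamma] is itself a test direction. *)
  have [_ var0] := hstat _ (hVX _ hgamma).
  have var_radial : first_variation E gamma gamma = alpha * E gamma.
    exact: cvg_lim (cvg_radial_variation hE hgamma).
  move/eqP: var0; rewrite var_radial.
  by rewrite mulf_eq0 => /orP[] /eqP; [left|right].
move=> r r0 Phi XPhi.
have Xr : X (r^-1 *: Phi).
  (* [submod_closed] gives closure under [a *: u + v]; taking [v = 0] leaves pure scaling. *)
  have [X0 XD] := hX.
  by have := XD r^-1 Phi 0 (mem_set XPhi) X0; rewrite addr0 => /set_mem.
have [[Vnear cvgq] var0] := hstat _ Xr.
(* [cvg] means convergence to [lim], which is the first variation here, so stationarity turns [cvgq]
   into convergence to 0. *)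
have := cvgq; rewrite -/(first_variation E gamma (r^-1 *: Phi)) var0.
move=> /(cvg_variation_scale hE r0 hgamma Vnear); rewrite mulr0 => cvg0.
split; last exact: cvg_lim cvg0.
by split; [exact: near_admissible_scale|apply/cvg_ex; exists 0].
Qed.
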